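(* Let $k \ge 1$, $m = 4k+2$, $\theta = 2\pi/m$, and let $P$ be a finite point set in general position. For any two vertices $u, w \in P$, let $M$ be the midpoint of the side of $T_{uw}$ opposite $u$ and let $\alpha$ be the unsigned angle between $uw$ and $uM$. Then the $\theta_m$-graph on $P$ contains a path from $u$ to $w$ of length at most $$\left(\frac{1 + \sin(\theta/2)}{\cos(\theta/2)}\cos\alpha + \sin\alpha\right)|uw|.$$
   Context: Cones: for $m \ge 2$, $\theta = 2\pi/m$; around each point $u$ draw $m$ rays with consecutive angular separation $\theta$, oriented so the vertical upward ray from $u$ bisects a cone, called $C_0^u$; cones are numbered $C_0^u,\dots,C_{m-1}^u$ clockwise, with the same orientation at every point. General position: no two points on a line parallel to a cone boundary ray, no two points on a line perpendicular to a cone bisector, no three points collinear. The $\theta_m$-graph on $P$: vertex set $P$; for each $u \in P$ and each cone $C_i^u$ containing a point of $P\setminus\{u\}$, add an edge from $u$ to the point $v \in C_i^u$ whose orthogonal projection onto the bisector of $C_i^u$ is closest to $u$. Edges are weighted by Euclidean length. Canonical triangle: if $w$ lies in cone $C$ of $u$, $T_{uw}$ is the triangle bounded by the two boundary rays of $C$ and the line through $w$ perpendicular to the bisector of $C$. *)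

(* Defs.v *)
From Stdlib Require Import Reals List.
Import ListNotations.
Open Scope R_scope.

Definition point := (R * R)%type.

Definition vsub (a b : point) : point := (fst a - fst b, snd a - snd b).
Definition dot (a b : point) : R := fst a * fst b + snd a * snd b.
Definition cross (a b : point) : R := fst a * snd b - snd a * fst b.
Definition edist (a b : point) : R :=
  sqrt ((fst a - fst b) ^ 2 + (snd a - snd b) ^ 2).

Definition theta (m : nat) : R := 2 * PI / INR m.

Definition dir (phi : R) : point := (cos phi, sin phi).

(** Cone C_i is bisected by the direction at angle pi/2 - i*theta:
    C_0 is bisected by the vertical upward ray and cones are numbered
    clockwise. *)
Definition bisector (m i : nat) : point := dir (PI / 2 - INR i * theta m).

(** v lies in cone C_i^u : the angle between v - u and the bisector of
    C_i is at most theta/2 (closed cone; boundaries are irrelevant under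
    general position). *)
Definition in_cone (m i : nat) (u v : point) : Prop :=
  (i < m)%nat /\ v <> u /\
  dot (vsub v u) (bisector m i) >= edist u v * cos (theta m / 2).

Definition proj (m i : nat) (u v : point) : R := dot (vsub v u) (bisector m i).

(** General position: boundary rays of the cones have directions
    pi/2 + theta/2 - j*theta. *)
Definition general_position (m : nat) (P : list point) : Prop :=
  forall u v, In u P -> In v P -> u <> v ->
    (forall j : nat,
        cross (vsub v u) (dir (PI / 2 + theta m / 2 - INR j * theta m)) <> 0) /\
    (forall j : nat, dot (vsub v u) (bisector m j) <> 0) /\
    (forall w, In w P -> w <> u -> w <> v -> cross (vsub v u) (vsub w u) <> 0).

Definition theta_dedge (m : nat) (P : list point) (u v : point) : Prop :=
  In u P /\ In v P /\
  exists i, in_cone m i u v /\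
    forall x, In x P -> in_cone m i u x -> proj m i u v <= proj m i u x.

Definition theta_adj (m : nat) (P : list point) (u v : point) : Prop :=
  theta_dedge m P u v \/ theta_dedge m P v u.

Fixpoint is_walk (adj : point -> point -> Prop) (x : point) (l : list point)
  : Prop :=
  match l with
  | [] => True
  | y :: l' => adj x y /\ is_walk adj y l'
  end.

Fixpoint path_length (x : point) (l : list point) : R :=
  match l with
  | [] => 0
  | y :: l' => edist x y + path_length y l'
  end.

Definition angle (a b : point) : R :=
  acos (dot a b / (sqrt (dot a a) * sqrt (dot b b))).

(** Midpoint of the side of T_uw opposite u, when w lies in C_i^u:
    it is the foot of the bisector on the line through w perpendicular
    to the bisector. *)
Definition tri_mid (m i : nat) (u w : point) : point :=
  (fst u + proj m i u w * fst (bisector m i),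
   snd u + proj m i u w * snd (bisector m i)).

(* Main.v *)
Require Import Defs.
From Stdlib Require Import Reals List Lra Lia Psatz Classical.
Import ListNotations.
Open Scope R_scope.

(** Measured in a frame whose second axis bisects the cone, the route from [u] to
    [w] through the left corner of the canonical triangle has length
    [L (w - u) = kappa y + x] with [kappa = (1 + sin h) / cos h] and [h = theta / 2],
    a linear form, so such bounds add up along a path. Two claims are proved
    together, for all cones and both orientations, by induction on the height of
    the canonical triangle: the distance from [u] to [w] is at most the longer of
    the two corner routes, and it is at most the left route [L] as soon as every
    point in the part of the triangle to the right of [u w] sees [w] in the same
    cone. If there are such points, the lowest one splits the pair into two smaller
    ones; otherwise go from [u] to its neighbour [v]. When [w] lies in the cone of
    [v] pointing the same way, or sideways in the upper half of the horizontal cone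
    or above, the induction hypothesis for [v, w] gives [L (w - v)]. When [w] lies
    in the lower half of the horizontal cone, use the second claim from [w] to [v]:
    for [m = 4k + 2] horizontal lines are cone boundaries, the upper corner route
    there has length exactly [L (w - v)], and the other part of that triangle below
    the level of [v] contains no point because [v] is the neighbour of [u]. *)

Local Ltac mult_pos :=
  repeat match goal with |- 0 <= _ * _ => apply Rmult_le_pos end; try lra; try nra.

(** * Trigonometry of the half angle and the constant [kappa] *)

Section Angles.

Variable k : nat.
Hypothesis k_pos : (1 <= k)%nat.

Definition half_angle : R := theta (4 * k + 2) / 2.

Local Notation h := half_angle.

(** This is [1 / cos h + tan h]: in a canonical triangle of height 1, a slanted side plus half of
    the opposite side. *)
Definition kappa : R := (1 + sin h) / cos h.

Lemma theta_half_angle : theta (4 * k + 2) = 2 * h.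
Proof. unfold half_angle; lra. Qed.

(** Cone boundaries lie at odd multiples of [h] from a bisector, so each bisector is perpendicular
    to a cone boundary. This is the property special to [m = 4k + 2]. *)
Lemma half_angle_mul : (2 * INR k + 1) * h = PI / 2.
Proof.
  unfold half_angle, theta.
  rewrite plus_INR, mult_INR; simpl (INR 4); simpl (INR 2).
  pose proof (pos_INR k). field; lra.
Qed.

Lemma INR_k_ge1 : 1 <= INR k.
Proof. apply (le_INR 1), k_pos. Qed.

Lemma half_angle_pos : 0 < h.
Proof.
  pose proof half_angle_mul; pose proof INR_k_ge1; pose proof PI_RGT_0; nra.
Qed.

Lemma half_angle_le : 3 * h <= PI / 2.
Proof.
  pose proof half_angle_mul; pose proof INR_k_ge1; pose proof half_angle_pos; nra.
Qed.

Lemma cos_half_pos : 0 < cos h.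
Proof.
  pose proof half_angle_pos; pose proof half_angle_le.
  apply cos_gt_0; lra.
Qed.

Lemma sin_half_pos : 0 < sin h.
Proof.
  pose proof half_angle_pos; pose proof half_angle_le.
  apply sin_gt_0; lra.
Qed.

Lemma sin_half_le : 2 * sin h <= 1.
Proof.
  pose proof half_angle_pos; pose proof half_angle_le.
  enough (sin h <= sin (PI / 6)) by (rewrite sin_PI6 in *; lra).
  apply sin_incr_1; lra.
Qed.

Lemma tan_half_cos : tan h * cos h = sin h.
Proof. pose proof cos_half_pos; unfold tan; field; lra. Qed.

Lemma tan_half_pos : 0 < tan h.
Proof.
  pose proof tan_half_cos; pose proof cos_half_pos; pose proof sin_half_pos; nra.
Qed.

Lemma kappa_cos : kappa * cos h = 1 + sin h.
Proof. pose proof cos_half_pos; unfold kappa; field; lra. Qed.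

Lemma kappa_pos : 0 < kappa.
Proof.
  pose proof kappa_cos; pose proof cos_half_pos; pose proof sin_half_pos; nra.
Qed.

Lemma sin_cos_half : sin h * sin h + cos h * cos h = 1.
Proof. pose proof (sin2_cos2 h) as H; unfold Rsqr in H; lra. Qed.

Lemma kappa_tan : kappa * kappa - 2 * kappa * tan h = 1.
Proof.
  pose proof cos_half_pos.
  apply (Rmult_eq_reg_r (cos h * cos h)); [|nra].
  replace ((kappa * kappa - 2 * kappa * tan h) * (cos h * cos h))
    with ((kappa * cos h) * (kappa * cos h) - 2 * (kappa * cos h) * (tan h * cos h)) by ring.
  rewrite kappa_cos, tan_half_cos. pose proof sin_cos_half. lra.
Qed.

(** By [kappa_tan] the squares of the two sides differ by exactly [2 kappa y (x + tan h y)], which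
    vanishes on the left boundary. *)
Lemma norm_le_corner (x y : R) :
  0 < y -> - (tan h * y) <= x -> sqrt (x ^ 2 + y ^ 2) <= kappa * y + x.
Proof.
  intros Hy Hx.
  pose proof kappa_tan; pose proof kappa_pos; pose proof tan_half_pos.
  assert (Hkt : tan h < kappa) by nra.
  assert (0 <= kappa * y + x) by nra.
  rewrite <- (sqrt_pow2 (kappa * y + x)) by assumption.
  apply sqrt_le_1_alt.
  assert (0 <= kappa * y * (x + tan h * y)) by mult_pos.
  nra.
Qed.

(** Replaces the angular definition of a cone by linear inequalities. The zero vector is excluded
    because it satisfies the dot product bound. *)
Lemma cone_of_dot (x y : R) :
  (x <> 0 \/ y <> 0) -> y >= sqrt (x ^ 2 + y ^ 2) * cos h ->
  0 < y /\ - (tan h * y) <= x <= tan h * y.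
Proof.
  intros Hxy Hd.
  pose proof cos_half_pos; pose proof sin_half_pos; pose proof tan_half_cos.
  pose proof tan_half_pos; pose proof sin_cos_half.
  assert (Hs : 0 < x ^ 2 + y ^ 2) by (destruct Hxy; nra).
  pose proof (sqrt_lt_R0 _ Hs).
  assert (Hq : sqrt (x ^ 2 + y ^ 2) * sqrt (x ^ 2 + y ^ 2) = x ^ 2 + y ^ 2)
    by (apply sqrt_sqrt; lra).
  set (r := sqrt (x ^ 2 + y ^ 2)) in *.
  assert (Hy : 0 < y) by nra.
  assert ((r * cos h) * (r * cos h) <= y * y) by (apply Rmult_le_compat; nra).
  assert (Hc : x * x * (cos h * cos h) <= y * y * (sin h * sin h)) by nra.
  assert (Hx : x * x <= (tan h * y) * (tan h * y)).
  { apply (Rmult_le_reg_r (cos h * cos h)); [nra|].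
    replace (tan h * y * (tan h * y) * (cos h * cos h))
      with (y * y * ((tan h * cos h) * (tan h * cos h))) by ring.
    rewrite tan_half_cos; lra. }
  split; [assumption|].
  assert (0 < tan h * y) by nra.
  apply Rsqr_le_abs_0 in Hx. rewrite (Rabs_pos_eq (tan h * y)) in Hx by lra.
  split; revert Hx; unfold Rabs; destruct (Rcase_abs x); lra.
Qed.

Lemma dot_of_cone (x y : R) :
  0 < y -> - (tan h * y) <= x <= tan h * y -> y >= sqrt (x ^ 2 + y ^ 2) * cos h.
Proof.
  intros Hy Hx.
  pose proof cos_half_pos; pose proof tan_half_cos; pose proof sin_cos_half.
  assert (Hs : 0 <= x ^ 2 + y ^ 2) by nra.
  assert (Hxc : x ^ 2 <= (tan h * y) ^ 2) by nra.
  apply Rle_ge, (Rmult_le_reg_r (/ cos h)); [now apply Rinv_0_lt_compat|].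
  rewrite Rmult_assoc, Rinv_r, Rmult_1_r by lra.
  assert (0 <= y * / cos h) by (apply Rmult_le_pos; [lra|left; now apply Rinv_0_lt_compat]).
  rewrite <- (sqrt_pow2 (y * / cos h)) by assumption.
  apply sqrt_le_1_alt.
  apply (Rmult_le_reg_r (cos h ^ 2)); [nra|].
  replace ((y * / cos h) ^ 2 * cos h ^ 2) with (y ^ 2) by (field; lra).
  replace (tan h * y) with (sin h * y / cos h) in Hxc by (unfold tan; field; lra).
  apply (Rmult_le_compat_r (cos h ^ 2)) in Hxc; [|nra].
  replace ((sin h * y / cos h) ^ 2 * cos h ^ 2) with ((sin h * sin h) * y ^ 2) in Hxc
    by (field; lra).
  nra.
Qed.

(** * Rotation by multiples of the cone angle *)

(** With [rot_y], the coordinates of [(x, y)] in axes turned clockwise by [i] cones. *)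
Definition rot_x (i : nat) (x y : R) : R :=
  cos (INR i * (2 * h)) * x - sin (INR i * (2 * h)) * y.
Definition rot_y (i : nat) (x y : R) : R :=
  sin (INR i * (2 * h)) * x + cos (INR i * (2 * h)) * y.

Lemma rot_angle_bounds (i : nat) :
  (1 <= i <= k)%nat -> 2 * h <= INR i * (2 * h) <= PI / 2 - h.
Proof.
  intros [H1 H2]. apply le_INR in H1, H2. simpl in H1.
  pose proof half_angle_mul; pose proof half_angle_pos. nra.
Qed.

Lemma rot_sin_pos (i : nat) : (1 <= i <= k)%nat -> 0 < sin (INR i * (2 * h)).
Proof.
  intros Hi; pose proof (rot_angle_bounds i Hi); pose proof half_angle_pos.
  apply sin_gt_0; lra.
Qed.

Lemma rot_cos_pos (i : nat) : (1 <= i <= k)%nat -> 0 < cos (INR i * (2 * h)).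
Proof.
  intros Hi; pose proof (rot_angle_bounds i Hi); pose proof half_angle_pos.
  apply cos_gt_0; lra.
Qed.

(** The bisector of the [k]-th cone clockwise is at angle [h] above the horizontal, so the lower
    boundary of that cone is horizontal. *)
Lemma rot_k : cos (INR k * (2 * h)) = sin h /\ sin (INR k * (2 * h)) = cos h.
Proof.
  pose proof half_angle_mul.
  replace (INR k * (2 * h)) with (PI / 2 - h) by lra.
  now rewrite cos_shift, sin_shift.
Qed.

(** The first boundary ray that lies clockwise of [(x, y)] ends the cone
    containing it; the ray at angle [PI/2] is such a boundary. *)
Lemma cone_cover (x y : R) :
  0 < y -> tan h * y < x ->
  exists i, (1 <= i <= k)%nat /\ 0 < rot_y i x y /\
    - (tan h * rot_y i x y) <= rot_x i x y <= tan h * rot_y i x y.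
Proof.
  intros Hy Hx.
  pose proof cos_half_pos; pose proof tan_half_cos; pose proof tan_half_pos.
  assert (Hn : forall n, (n <= k)%nat ->
    (exists i, (1 <= i <= n)%nat /\ 0 < rot_y i x y /\
      - (tan h * rot_y i x y) <= rot_x i x y <= tan h * rot_y i x y)
    \/ 0 < x * cos ((2 * INR n + 1) * h) - y * sin ((2 * INR n + 1) * h)).
  { induction n as [|n IH]; intros Hn.
    - right. simpl INR. replace ((2 * 0 + 1) * h) with h by ring.
      rewrite <- tan_half_cos. nra.
    - destruct (IH ltac:(lia)) as [(i & Hi & Hc)|Hp].
      { left; exists i; split; [lia|assumption]. }
      destruct (Rlt_le_dec 0
        (x * cos ((2 * INR (S n) + 1) * h) - y * sin ((2 * INR (S n) + 1) * h))) as [Hq|Hq].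
      { now right. }
      left; exists (S n); split; [lia|].
      assert (Hi : (1 <= S n <= k)%nat) by lia.
      pose proof (rot_sin_pos _ Hi); pose proof (rot_cos_pos _ Hi).
      assert (Hry : 0 < rot_y (S n) x y) by (assert (0 < x) by nra; unfold rot_y; nra).
      split; [assumption|].
      replace ((2 * INR (S n) + 1) * h) with (INR (S n) * (2 * h) + h) in Hq by ring.
      replace ((2 * INR n + 1) * h) with (INR (S n) * (2 * h) - h) in Hp
        by (rewrite S_INR; ring).
      rewrite cos_plus, sin_plus in Hq. rewrite cos_minus, sin_minus in Hp.
      rewrite <- tan_half_cos in Hp, Hq. unfold rot_x, rot_y in *.
      split; (apply (Rmult_le_reg_r (cos h)); [lra|]); lra || nra. }
  destruct (Hn k (le_n k)) as [Hc|Hp]; [exact Hc|].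
  (* Beyond the [k]-th boundary, which is horizontal, [y] would be negative. *)
  rewrite half_angle_mul, cos_PI2, sin_PI2 in Hp. lra.
Qed.

(** With [tau = tan (i h)] and [t = tan h], the two inequalities below reduce to
    [(1 - kappa tau) (tau - t) >= 0] and [1 - t kappa >= tau (kappa + t)]. *)
Lemma rot_corner_le (i : nat) (x y : R) :
  (1 <= i <= k)%nat -> 0 < rot_y i x y ->
  - (tan h * rot_y i x y) <= rot_x i x y <= tan h * rot_y i x y ->
  (rot_x i x y <= 0 \/ (i < k)%nat) ->
  kappa * rot_y i x y + Rabs (rot_x i x y) <= kappa * y + x.
Proof.
  intros Hi Hy Hx Hor.
  set (X := rot_x i x y) in *. set (Y := rot_y i x y) in *.
  set (b := INR i * (2 * h)).
  assert (Hsc : sin b * sin b + cos b * cos b = 1)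
    by (pose proof (sin2_cos2 b) as H; unfold Rsqr in H; lra).
  assert (Ex : x = cos b * X + sin b * Y).
  { unfold X, Y, rot_x, rot_y; fold b.
    transitivity ((sin b * sin b + cos b * cos b) * x); [rewrite Hsc|]; ring. }
  assert (Ey : y = cos b * Y - sin b * X).
  { unfold X, Y, rot_x, rot_y; fold b.
    transitivity ((sin b * sin b + cos b * cos b) * y); [rewrite Hsc|]; ring. }
  rewrite Ex, Ey. clearbody X Y. clear Ex Ey x y.
  pose proof cos_half_pos; pose proof tan_half_cos; pose proof tan_half_pos.
  pose proof kappa_cos; pose proof kappa_pos; pose proof sin_cos_half.
  pose proof half_angle_mul as Hk; pose proof half_angle_pos.
  pose proof (rot_angle_bounds i Hi) as Hb. fold b in Hb.
  assert (Hi1 : 1 <= INR i) by (apply (le_INR 1); lia).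
  assert (Hik : INR i <= INR k) by (apply le_INR; lia).
  set (g := INR i * h).
  assert (Hg : h <= g <= PI / 4) by (unfold g, b in *; lra).
  assert (HC : 0 < cos g) by (apply cos_gt_0; lra).
  assert (HS : 0 < sin g) by (apply sin_gt_0; lra).
  assert (Hg1 : sin g * sin g + cos g * cos g = 1)
    by (pose proof (sin2_cos2 g) as H6; unfold Rsqr in H6; lra).
  replace b with (2 * g) in * by (unfold b, g; ring). clear b.
  rewrite sin_2a, cos_2a in *.
  (* As [kappa = tan (PI/4 + h/2)], this says [2 g + h <= PI/2], which is [i <= k]. *)
  assert (Hq1 : 0 <= cos g - kappa * sin g).
  { apply (Rmult_le_reg_r (cos h)); [assumption|].
    replace ((cos g - kappa * sin g) * cos h)
      with (cos g * cos h - (kappa * cos h) * sin g) by ring.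
    rewrite kappa_cos.
    replace (cos g * cos h - (1 + sin h) * sin g)
      with (cos g * cos h - sin g * sin h - sin g) by ring.
    rewrite <- cos_plus. rewrite <- (cos_shift g).
    enough (cos (PI / 2 - g) <= cos (g + h)) by lra.
    apply cos_decr_1; unfold g in *; nra. }
  assert (Hq2 : 0 <= sin g - tan h * cos g).
  { apply (Rmult_le_reg_r (cos h)); [assumption|].
    replace ((sin g - tan h * cos g) * cos h)
      with (sin g * cos h - cos g * (tan h * cos h)) by ring.
    rewrite tan_half_cos, <- sin_minus.
    enough (0 <= sin (g - h)) by lra.
    apply sin_ge_0; lra. }
  unfold Rabs; destruct (Rcase_abs X) as [Hneg|Hpos].
  - assert (0 <= (cos g - kappa * sin g) * (sin g - tan h * cos g) * Y)
      by mult_pos.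
    assert (0 <= (tan h * Y + X) * (cos g * (cos g - kappa * sin g)))
      by mult_pos.
    assert (kappa * Y + - X = (kappa * Y + - X) * (sin g * sin g + cos g * cos g))
      by (rewrite Hg1; ring).
    lra.
  - assert (kappa * Y + X = (kappa * Y + X) * (sin g * sin g + cos g * cos g))
      by (rewrite Hg1; ring).
    (* The inequality amounts to [2 g + 3 h <= PI/2], that is [i + 1 <= k]; for [i = k] only the
       bisector [X = 0] is left on this side. *)
    assert (Hcase : X = 0 \/ 0 <= (1 - tan h * kappa) * cos g - (kappa + tan h) * sin g).
    { destruct Hor as [Hle|Hlt]; [left; lra|right].
      assert (Hik1 : INR i + 1 <= INR k) by (rewrite <- S_INR; apply le_INR; lia).
      apply (Rmult_le_reg_r (cos h * cos h)); [nra|].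
      replace (((1 - tan h * kappa) * cos g - (kappa + tan h) * sin g) * (cos h * cos h))
        with ((cos h * cos h - (tan h * cos h) * (kappa * cos h)) * cos g
              - ((kappa * cos h) * cos h + (tan h * cos h) * cos h) * sin g) by ring.
      rewrite tan_half_cos, kappa_cos.
      replace ((cos h * cos h - sin h * (1 + sin h)) * cos g
               - ((1 + sin h) * cos h + sin h * cos h) * sin g)
        with ((cos h * cos h - sin h * sin h) * cos g - (2 * sin h * cos h) * sin g
              - (sin h * cos g + cos h * sin g)) by ring.
      rewrite <- cos_2a, <- sin_2a, <- cos_plus, <- sin_plus, <- (cos_shift (h + g)).
      enough (cos (PI / 2 - (h + g)) <= cos (2 * h + g)) by lra.
      apply cos_decr_1; unfold g in *; nra. }
    destruct Hcase as [->|Hq3].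
    + assert (0 <= (cos g - kappa * sin g) * sin g * Y) by mult_pos.
      lra.
    + assert (0 <= ((1 - tan h * kappa) * cos g - (kappa + tan h) * sin g) * sin g * Y)
        by mult_pos.
      assert (0 <= (tan h * Y - X) * (sin g * (sin g + kappa * cos g)))
        by mult_pos.
      lra.
Qed.

(** Makes the induction measure decrease; [b] stands for the height of [v] over [u], and [(x, y)]
    for [w - v]. For the rotation angle [a], from [2 h <= a <= PI/2 - h] follow
    [tan h sin a + cos a <= 1] and [2 tan h sin a <= 2 sin h <= 1]. *)
Lemma rot_y_lt (i : nat) (b x y : R) :
  (1 <= i <= k)%nat -> 0 < b -> 0 < y -> x < tan h * (2 * b + y) ->
  rot_y i x y < b + y.
Proof.
  intros Hi Hb Hy Hx.
  pose proof (rot_sin_pos i Hi); pose proof (rot_angle_bounds i Hi).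
  pose proof cos_half_pos; pose proof tan_half_cos; pose proof tan_half_pos.
  pose proof sin_half_le; pose proof half_angle_pos.
  unfold rot_y; set (a := INR i * (2 * h)) in *.
  assert (Hq1 : tan h * sin a + cos a <= 1).
  { apply (Rmult_le_reg_r (cos h)); [assumption|].
    replace ((tan h * sin a + cos a) * cos h)
      with (cos a * cos h + sin a * (tan h * cos h)) by ring.
    rewrite tan_half_cos, <- cos_minus, Rmult_1_l.
    apply cos_decr_1; lra. }
  assert (Hq2 : sin a <= cos h).
  { rewrite <- sin_shift. apply sin_incr_1; lra. }
  assert (Hq3 : 2 * (tan h * sin a) <= 1) by nra.
  assert (sin a * x < sin a * (tan h * (2 * b + y))) by (apply Rmult_lt_compat_l; lra).
  assert (b * (2 * (tan h * sin a)) <= b * 1) by (apply Rmult_le_compat_l; lra).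
  assert (y * (tan h * sin a + cos a) <= y * 1) by (apply Rmult_le_compat_l; lra).
  nra.
Qed.


(** * The cone with a horizontal boundary *)

Lemma cos_2half_pos : 0 < cos (2 * h).
Proof.
  pose proof half_angle_pos; pose proof half_angle_le. apply cos_gt_0; lra.
Qed.

(** Equivalent to [2 h <= PI/2 - h]: the upper boundary of the horizontal cone is no steeper than
    the right boundary of the vertical one. *)
Lemma tan_half_le_cot : tan h * sin (2 * h) <= cos (2 * h).
Proof.
  pose proof cos_half_pos; pose proof half_angle_pos; pose proof half_angle_le.
  apply (Rmult_le_reg_r (cos h)); [assumption|].
  replace (tan h * sin (2 * h) * cos h) with (sin (2 * h) * (tan h * cos h)) by ring.
  rewrite tan_half_cos.
  enough (0 <= cos (2 * h + h)) by (rewrite cos_plus in *; lra).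
  apply cos_ge_0; lra.
Qed.

(** Membership of [(x, y)] in the cone spanned by the [x]-axis and the ray at
    angle [2 h] above it, whose bisector makes an angle [h] with that axis. *)
Lemma horizontal_cone (x y : R) :
  - (tan h * (cos h * x + sin h * y)) <= sin h * x - cos h * y
     <= tan h * (cos h * x + sin h * y)
  <-> 0 <= y /\ y * cos (2 * h) <= x * sin (2 * h).
Proof.
  pose proof cos_half_pos; pose proof tan_half_cos; pose proof sin_cos_half.
  assert (Hm : forall a b, a * cos h <= b * cos h <-> a <= b).
  { intros a b; split; intros; nra. }
  replace (tan h * (cos h * x + sin h * y)) with ((tan h * cos h) * x + tan h * sin h * y)
    by ring.
  rewrite tan_half_cos.
  assert (E : tan h * sin h * cos h = sin h * sin h) by nra.
  rewrite cos_2a, sin_2a.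
  rewrite <- (Hm (- _)), <- (Hm (sin h * x - cos h * y)).
  replace ((sin h * x + tan h * sin h * y) * cos h)
    with (sin h * cos h * x + (tan h * sin h * cos h) * y) by ring.
  replace (- (sin h * x + tan h * sin h * y) * cos h)
    with (- (sin h * cos h * x + (tan h * sin h * cos h) * y)) by ring.
  rewrite E.
  assert (Hy : y = (sin h * sin h + cos h * cos h) * y) by (rewrite sin_cos_half; ring).
  split; intros [? ?]; split; lra.
Qed.

(** * Frames, and cones in frame coordinates *)

Local Notation m := (4 * k + 2)%nat.

Lemma bisector_period (j q : nat) : bisector m (j + m * q) = bisector m j.
Proof.
  unfold bisector, dir.
  replace (PI / 2 - INR j * theta m)
    with (PI / 2 - INR (j + m * q) * theta m + 2 * INR q * PI).
  - now rewrite cos_period, sin_period.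
  - rewrite (plus_INR j), (mult_INR m q). unfold theta. field.
    apply not_0_INR; lia.
Qed.

(** Frames allow any cone index, whereas [in_cone] asks for one below [m]. *)
Lemma bisector_mod (j : nat) : bisector m (j mod m) = bisector m j.
Proof.
  rewrite <- (bisector_period _ (j / m)). f_equal.
  pose proof (Nat.div_mod_eq j m). lia.
Qed.

(** A frame is an orthonormal basis whose second axis [fst F] bisects a cone;
    both orientations are allowed, so that mirror images come for free. *)
Definition is_frame (F : point * point) : Prop :=
  exists j, fst F = bisector m j /\
    (snd F = (snd (bisector m j), - fst (bisector m j)) \/
     snd F = (- snd (bisector m j), fst (bisector m j))).

Definition xc (F : point * point) (p : point) : R := dot p (snd F).
Definition yc (F : point * point) (p : point) : R := dot p (fst F).

Definition flip (F : point * point) : point * point :=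
  (fst F, (- fst (snd F), - snd (snd F))).
Definition oppose (F : point * point) : point * point :=
  ((- fst (fst F), - snd (fst F)), snd F).
Definition rotate (i : nat) (F : point * point) : point * point :=
  let a := INR i * (2 * h) in
  ((cos a * fst (fst F) + sin a * fst (snd F),
    cos a * snd (fst F) + sin a * snd (snd F)),
   (cos a * fst (snd F) - sin a * fst (fst F),
    cos a * snd (snd F) - sin a * snd (fst F))).

Lemma is_frame_flip F : is_frame F -> is_frame (flip F).
Proof.
  intros (j & He & [Hf|Hf]); exists j; (split; [exact He|]); [right|left];
    unfold flip; cbn [fst snd]; rewrite Hf; cbn [fst snd]; f_equal; ring.
Qed.

(** Since [m] is even, the reversed bisector belongs to the cone [m / 2 = 2k + 1] steps further. *)
Lemma is_frame_oppose F : is_frame F -> is_frame (oppose F).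
Proof.
  intros (j & He & Hf); exists (j + (2 * k + 1))%nat.
  assert (E : bisector m (j + (2 * k + 1))
              = (- fst (bisector m j), - snd (bisector m j))).
  { unfold bisector, dir; cbn [fst snd].
    replace (PI / 2 - INR (j + (2 * k + 1)) * theta m)
      with (- (- (PI / 2 - INR j * theta m) + PI)).
    - rewrite cos_neg, sin_neg, neg_cos, neg_sin, cos_neg, sin_neg. f_equal; ring.
    - rewrite theta_half_angle, (plus_INR j), plus_INR, mult_INR.
      pose proof half_angle_mul; simpl INR; lra. }
  rewrite E; unfold oppose; cbn [fst snd]; rewrite He.
  split; [reflexivity|].
  destruct Hf as [-> | ->]; [right|left]; cbn [fst snd]; f_equal; ring.
Qed.

Lemma is_frame_rotate i F : is_frame F -> is_frame (rotate i F).
Proof.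
  intros (j & He & Hf).
  set (a := INR i * (2 * h)).
  assert (E1 : bisector m (j + i) =
    (cos (PI / 2 - INR j * theta m - a), sin (PI / 2 - INR j * theta m - a))).
  { unfold bisector, dir. rewrite plus_INR, theta_half_angle. unfold a.
    f_equal; f_equal; ring. }
  (* In a mirrored frame the rotation lowers the index by [i]; adding [(m - 1) i] instead keeps it a
     natural number. *)
  assert (E2 : bisector m (j + (4 * k + 1) * i) =
    (cos (PI / 2 - INR j * theta m + a), sin (PI / 2 - INR j * theta m + a))).
  { replace (PI / 2 - INR j * theta m + a)
      with (PI / 2 - INR (j + (4 * k + 1) * i) * theta m + 2 * INR i * PI).
    - now rewrite cos_period, sin_period.
    - rewrite (plus_INR j), (mult_INR _ i), plus_INR, mult_INR.
      unfold a; rewrite theta_half_angle; simpl INR.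
      pose proof half_angle_mul. nra. }
  unfold bisector, dir in He, Hf; cbn [fst snd] in Hf.
  set (p := PI / 2 - INR j * theta m) in *.
  destruct Hf as [Hf|Hf]; [exists (j + i)%nat; rewrite E1|
    exists (j + (4 * k + 1) * i)%nat; rewrite E2];
    unfold rotate; fold a; cbn [fst snd]; rewrite He, Hf; cbn [fst snd];
    rewrite ?cos_minus, ?sin_minus, ?cos_plus, ?sin_plus;
    (split; [|(left + right)]); f_equal; ring.
Qed.

Lemma xc_flip F p : xc (flip F) p = - xc F p.
Proof. unfold xc, flip, dot; cbn [fst snd]; ring. Qed.

Lemma yc_flip F p : yc (flip F) p = yc F p.
Proof. reflexivity. Qed.

Lemma xc_oppose F p : xc (oppose F) p = xc F p.
Proof. reflexivity. Qed.

Lemma yc_oppose F p : yc (oppose F) p = - yc F p.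
Proof. unfold yc, oppose, dot; cbn [fst snd]; ring. Qed.

Lemma xc_rotate i F p : xc (rotate i F) p = rot_x i (xc F p) (yc F p).
Proof. unfold xc, yc, rot_x, rotate, dot; cbn [fst snd]; ring. Qed.

Lemma yc_rotate i F p : yc (rotate i F) p = rot_y i (xc F p) (yc F p).
Proof. unfold xc, yc, rot_y, rotate, dot; cbn [fst snd]; ring. Qed.

Lemma rot_x_sub i a b a' b' : rot_x i a b - rot_x i a' b' = rot_x i (a - a') (b - b').
Proof. unfold rot_x; ring. Qed.

Lemma rot_y_sub i a b a' b' : rot_y i a b - rot_y i a' b' = rot_y i (a - a') (b - b').
Proof. unfold rot_y; ring. Qed.

Lemma bisector_unit j :
  fst (bisector m j) * fst (bisector m j) + snd (bisector m j) * snd (bisector m j) = 1.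
Proof.
  unfold bisector, dir; cbn [fst snd].
  pose proof (sin2_cos2 (PI / 2 - INR j * theta m)) as E; unfold Rsqr in E; lra.
Qed.

Lemma frame_dist2 F u w :
  is_frame F ->
  (xc F w - xc F u) ^ 2 + (yc F w - yc F u) ^ 2
  = (fst u - fst w) ^ 2 + (snd u - snd w) ^ 2.
Proof.
  intros (j & He & Hf). pose proof (bisector_unit j) as E.
  unfold xc, yc, dot; rewrite He.
  destruct Hf as [-> | ->]; cbn [fst snd];
    (transitivity (((fst u - fst w) ^ 2 + (snd u - snd w) ^ 2) *
      (fst (bisector m j) * fst (bisector m j) + snd (bisector m j) * snd (bisector m j)));
     [ring|rewrite E; ring]).
Qed.

Lemma frame_edist F u w :
  is_frame F ->
  edist u w = sqrt ((xc F w - xc F u) ^ 2 + (yc F w - yc F u) ^ 2).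
Proof. intros HF; unfold edist; now rewrite frame_dist2. Qed.

Definition cone (F : point * point) (u w : point) : Prop :=
  0 < yc F w - yc F u /\
  - (tan h * (yc F w - yc F u)) <= xc F w - xc F u <= tan h * (yc F w - yc F u).

(** A cross product in frame coordinates: right is the side where [xc] grows, so [flip] exchanges
    the sides. *)
Definition right_of (F : point * point) (u w x : point) : Prop :=
  0 < (xc F x - xc F u) * (yc F w - yc F u) - (yc F x - yc F u) * (xc F w - xc F u).

Lemma cone_neq F u w : cone F u w -> u <> w.
Proof. intros [H0 _] <-; lra. Qed.

Lemma cone_flip F u w : cone F u w -> cone (flip F) u w.
Proof. unfold cone; rewrite !yc_flip, !xc_flip. intros; lra. Qed.

Lemma cone_trans F u v w : cone F u v -> cone F v w -> cone F u w.
Proof. unfold cone; intros; lra. Qed.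

Lemma in_cone_iff F j u w :
  (j < m)%nat -> is_frame F -> fst F = bisector m j ->
  in_cone m j u w <-> cone F u w.
Proof.
  intros Hj HF He. unfold in_cone, cone.
  assert (Ed : dot (vsub w u) (bisector m j) = yc F w - yc F u)
    by (unfold yc, dot, vsub; rewrite He; cbn [fst snd]; ring).
  rewrite Ed, (frame_edist F u w HF). fold half_angle.
  split.
  - intros (_ & Hne & Hd). apply cone_of_dot; [|exact Hd].
    destruct (Req_dec (xc F w - xc F u) 0) as [Hx|Hx]; [right|now left].
    intros Hy. pose proof (frame_dist2 F u w HF) as E.
    rewrite Hx, Hy in E. apply Hne.
    destruct u as [u1 u2], w as [w1 w2]; cbn [fst snd] in E.
    pose proof (pow2_ge_0 (u1 - w1)); pose proof (pow2_ge_0 (u2 - w2)).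
    f_equal; apply Rminus_diag_uniq, Rsqr_0_uniq; unfold Rsqr; lra.
  - intros [Hy Hx]. split; [exact Hj|split].
    + intros ->; lra.
    + now apply dot_of_cone.
Qed.

(** * General position and nearest neighbours *)

Variable P : list point.
Hypothesis gp : general_position m P.

Lemma gp_yc F u v :
  is_frame F -> In u P -> In v P -> u <> v -> yc F v - yc F u <> 0.
Proof.
  intros (j & He & _) Hu Hv Huv.
  destruct (gp u v Hu Hv Huv) as (_ & Hb & _).
  replace (yc F v - yc F u) with (dot (vsub v u) (bisector m j)); [apply Hb|].
  unfold yc, dot, vsub; rewrite He; cbn [fst snd]; ring.
Qed.

Lemma gp_xc F u v :
  is_frame F -> In u P -> In v P -> u <> v ->
  xc F v - xc F u <> - (tan h * (yc F v - yc F u)).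
Proof.
  intros (j & He & Hf) Hu Hv Huv Eq.
  destruct (gp u v Hu Hv Huv) as (Hb & _ & _).
  pose proof cos_half_pos; pose proof tan_half_cos as Ht.
  assert (Eq' : (xc F v - xc F u) * cos h = - (sin h * (yc F v - yc F u)))
    by (rewrite Eq, <- Ht; ring).
  unfold xc, yc, dot in Eq'. rewrite He in Eq'.
  destruct Hf as [Hf|Hf]; rewrite Hf in Eq'; cbn [fst snd] in Eq'; unfold bisector, dir in Eq';
    cbn [fst snd] in Eq'.
  - apply (Hb j). fold half_angle. unfold cross, dir, vsub; cbn [fst snd].
    replace (PI / 2 + h - INR j * theta m) with (PI / 2 - INR j * theta m + h) by ring.
    rewrite cos_plus, sin_plus. lra.
  (* Mirrored, the left boundary of the frame is the clockwise boundary of the cone, hence ray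
     [S j]. *)
  - apply (Hb (S j)). fold half_angle. unfold cross, dir, vsub; cbn [fst snd].
    replace (PI / 2 + h - INR (S j) * theta m) with (PI / 2 - INR j * theta m - h)
      by (rewrite S_INR, theta_half_angle; ring).
    rewrite cos_minus, sin_minus. lra.
Qed.

Lemma exists_argmin (f : point -> R) (Q : point -> Prop) (l : list point) :
  (exists x, In x l /\ Q x) ->
  exists x, In x l /\ Q x /\ forall y, In y l -> Q y -> f x <= f y.
Proof.
  induction l as [|a l IH]; intros (x & Hx & HQ); [destruct Hx|].
  destruct (classic (exists y, In y l /\ Q y)) as [Hl|Hl].
  - destruct (IH Hl) as (z & Hz & HQz & Hmin).
    destruct (classic (Q a /\ f a <= f z)) as [[Ha Haz]|Ha].
    + exists a; split; [now left|split; [assumption|]].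
      intros y [->|Hy] HQy; [lra|]. specialize (Hmin y Hy HQy); lra.
    + exists z; split; [now right|split; [assumption|]].
      intros y [->|Hy] HQy; [|now apply Hmin].
      destruct (Rle_dec (f z) (f y)); [assumption|].
      exfalso; apply Ha; split; [assumption|lra].
  - exists a. destruct Hx as [->|Hx]; [|exfalso; eauto].
    split; [now left|split; [assumption|]].
    intros y [->|Hy] HQy; [lra|exfalso; eauto].
Qed.

Lemma closest_neighbour F u w :
  is_frame F -> In u P -> In w P -> cone F u w ->
  exists v, In v P /\ cone F u v /\ theta_adj m P u v /\
    forall z, In z P -> cone F u z -> yc F v <= yc F z.
Proof.
  intros HF Hu Hw Hc.
  destruct (exists_argmin (yc F) (cone F u) P) as (v & Hv & Hcv & Hmin); [eauto|].
  exists v; split; [assumption|split; [assumption|split; [|assumption]]].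
  left; split; [assumption|split; [assumption|]].
  pose proof HF as (j & He & _). rewrite <- bisector_mod in He.
  assert (Hj : (j mod m < m)%nat) by (apply Nat.mod_upper_bound; lia).
  exists (j mod m). split; [now apply (in_cone_iff F)|].
  intros x Hx Hcx. apply (in_cone_iff F) in Hcx; [|assumption..].
  specialize (Hmin x Hx Hcx).
  unfold proj, yc, dot, vsub in *; rewrite He in Hmin; cbn [fst snd]; lra.
Qed.

(** * Walks of bounded length, and simple paths extracted from them *)

(** Vertices may repeat, so that walks can be concatenated. The default [u] of [last] makes the
    empty list a walk from [u] to itself. *)
Definition connected_within (u w : point) (r : R) : Prop :=
  exists l, is_walk (theta_adj m P) u l /\ last l u = w /\ path_length u l <= r.

Lemma last_cons_default (A : Type) (a d : A) (l : list A) : last (a :: l) d = last l a.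
Proof.
  revert a d; induction l as [|b l IH]; intros a d; [reflexivity|].
  change (last (b :: l) d = last (b :: l) a). now rewrite !IH.
Qed.

Lemma connected_within_le u w r r' :
  connected_within u w r -> r <= r' -> connected_within u w r'.
Proof. intros (l & ? & ? & ?) ?; exists l; repeat split; auto; lra. Qed.

Lemma connected_within_edge u w : theta_adj m P u w -> connected_within u w (edist u w).
Proof. intros He; exists [w]; simpl; repeat split; auto; lra. Qed.

Lemma connected_within_trans u v w r s :
  connected_within u v r -> connected_within v w s -> connected_within u w (r + s).
Proof.
  intros (l & Hl & Hv & Hr) Hs. revert u r Hl Hv Hr.
  induction l as [|a l IH]; intros u r Hl Hv Hr.
  - simpl in *; subst u. apply (connected_within_le _ _ _ _ Hs); lra.
  - rewrite last_cons_default in Hv. destruct Hl as [Ha Hl]. cbn [path_length] in Hr.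
    destruct (IH a (path_length a l) Hl Hv (Rle_refl _)) as (l' & H1' & H2' & H3').
    exists (a :: l'); split; [now split|split].
    + now rewrite last_cons_default.
    + cbn [path_length]; lra.
Qed.

Lemma edist_sym u v : edist u v = edist v u.
Proof. unfold edist; f_equal; ring. Qed.

Lemma theta_adj_sym u v : theta_adj m P u v -> theta_adj m P v u.
Proof. unfold theta_adj; tauto. Qed.

Lemma connected_within_sym u w r : connected_within u w r -> connected_within w u r.
Proof.
  intros (l & Hl & Hw & Hr). apply connected_within_le with (2 := Hr); clear Hr r.
  revert u Hl Hw; induction l as [|a l IH]; intros u Hl Hw.
  - simpl in *; subst; exists []; simpl; repeat split; lra.
  - destruct Hl as [Ha Hl]; rewrite last_cons_default in Hw.
    cbn [path_length]. rewrite Rplus_comm.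
    apply connected_within_trans with a; [now apply IH|].
    rewrite edist_sym. now apply connected_within_edge, theta_adj_sym.
Qed.

(** The tail is made simple first; if [u] occurs on it, everything before that occurrence is cut
    off, which cannot lengthen the walk. *)
Lemma connected_within_simple u w r :
  connected_within u w r ->
  exists l, NoDup (u :: l) /\ is_walk (theta_adj m P) u l /\ last l u = w /\
    path_length u l <= r.
Proof.
  intros (l & Hl & Hw & Hr). enough (exists l',
    NoDup (u :: l') /\ is_walk (theta_adj m P) u l' /\ last l' u = w /\
    path_length u l' <= path_length u l) as (l' & ? & ? & ? & ?)
    by (exists l'; repeat split; auto; lra).
  clear r Hr. revert u Hl Hw; induction l as [|a l IH]; intros u Hl Hw.
  { exists []; repeat split; auto; [repeat constructor; intros []|lra]. }
  destruct Hl as [Ha Hl]; rewrite last_cons_default in Hw.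
  destruct (IH a Hl Hw) as (l' & Hnd & Hl' & Hw' & Hlen).
  assert (Hd : 0 <= edist u a) by apply sqrt_pos.
  cbn [path_length].
  destruct (classic (In u (a :: l'))) as [Hin|Hin].
  - enough (Hs : exists l'', NoDup (u :: l'') /\ is_walk (theta_adj m P) u l'' /\
        last l'' u = w /\ path_length u l'' <= path_length a l').
    { destruct Hs as (l'' & ? & ? & ? & ?); exists l''; repeat split; auto; lra. }
    clear - Hnd Hl' Hw' Hin.
    revert a Hnd Hl' Hw' Hin; induction l' as [|b l' IH]; intros a Hnd Hl' Hw' Hin.
    + destruct Hin as [->|[]]. exists []; repeat split; auto; lra.
    + destruct Hin as [->|Hin]; [exists (b :: l'); auto using Rle_refl|].
      rewrite last_cons_default in Hw'. inversion Hnd; subst.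
      destruct Hl' as [_ Hl'].
      destruct (IH b) as (l'' & ? & ? & ? & ?); auto.
      exists l''; repeat split; auto.
      assert (0 <= edist a b) by apply sqrt_pos. cbn [path_length]; lra.
  - exists (a :: l'); split; [now constructor|split; [now split|split]].
    + now rewrite last_cons_default.
    + cbn [path_length]; lra.
Qed.

(** Length of the route from [u] to [w] through the left corner of the
    canonical triangle; it is linear in [w - u], so that it telescopes. *)
Definition corner (F : point * point) (u w : point) : R :=
  kappa * (yc F w - yc F u) + (xc F w - xc F u).

(** Weakens the emptiness of the part of the canonical triangle to the right of
    [u w]: a point there must still see [w] in the same cone. *)
Definition right_free (F : point * point) (u w : point) : Prop :=
  forall x, In x P -> cone F u x -> yc F x <= yc F w -> right_of F u w x -> cone F x w.

(** The first bound is the larger of [corner] in [F] and in [flip F], so it ignores the orientation;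
    the second depends on it. *)
Definition bounded_pair (F : point * point) (u w : point) : Prop :=
  connected_within u w (kappa * (yc F w - yc F u) + Rabs (xc F w - xc F u)) /\
  (right_free F u w -> connected_within u w (corner F u w)).

Definition bounded_below (H : R) : Prop :=
  forall F u w, is_frame F -> In u P -> In w P -> cone F u w ->
    yc F w - yc F u < H -> bounded_pair F u w.

Lemma edge_le_corner F u w :
  is_frame F -> cone F u w -> edist u w <= corner F u w.
Proof.
  intros HF [Hy Hx]. rewrite (frame_edist F) by assumption.
  apply norm_le_corner; lra.
Qed.

(** * Looking back from [w] to [v] along the horizontal cone *)

(** The cone opposite to the [k]-th one clockwise has a horizontal upper boundary. As [oppose]
    reverses the orientation, left in this frame means up. *)
Definition horizontal_frame (F : point * point) : point * point := oppose (rotate k F).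

Lemma xc_horizontal F p : xc (horizontal_frame F) p = sin h * xc F p - cos h * yc F p.
Proof.
  unfold horizontal_frame. rewrite xc_oppose, xc_rotate. unfold rot_x.
  destruct rot_k as [-> ->]; ring.
Qed.

Lemma yc_horizontal F p : yc (horizontal_frame F) p = - (cos h * xc F p + sin h * yc F p).
Proof.
  unfold horizontal_frame. rewrite yc_oppose, yc_rotate. unfold rot_y.
  destruct rot_k as [-> ->]; ring.
Qed.

Lemma cone_horizontal F w z :
  cone (horizontal_frame F) w z <->
  0 < cos h * (xc F w - xc F z) + sin h * (yc F w - yc F z) /\
  0 <= yc F w - yc F z /\
  (yc F w - yc F z) * cos (2 * h) <= (xc F w - xc F z) * sin (2 * h).
Proof.
  rewrite <- horizontal_cone. unfold cone. rewrite !xc_horizontal, !yc_horizontal.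
  replace (- (cos h * xc F z + sin h * yc F z) - - (cos h * xc F w + sin h * yc F w))
    with (cos h * (xc F w - xc F z) + sin h * (yc F w - yc F z)) by ring.
  split; intros [? ?]; split; lra.
Qed.

(** Both routes pass through the same corner: the line through [v] perpendicular to the horizontal
    cone's bisector carries the left boundary of the upward cone of [v], and it meets the horizontal
    line through [w] there. *)
Lemma corner_horizontal F v w : corner (horizontal_frame F) w v = corner F v w.
Proof.
  unfold corner. rewrite !xc_horizontal, !yc_horizontal.
  pose proof cos_half_pos; pose proof kappa_cos; pose proof sin_cos_half.
  apply (Rmult_eq_reg_r (cos h)); [|lra].
  set (x := xc F w - xc F v). set (y := yc F w - yc F v).
  transitivity ((kappa * cos h) * (cos h * x + sin h * y) - (sin h * x - cos h * y) * cos h);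
    [unfold x, y; ring|].
  replace ((kappa * y + x) * cos h) with ((kappa * cos h) * y + x * cos h) by ring.
  rewrite kappa_cos.
  assert (y = (sin h * sin h + cos h * cos h) * y) by (rewrite sin_cos_half; ring).
  lra.
Qed.

Lemma right_of_horizontal F w v z :
  right_of (horizontal_frame F) w v z ->
  (xc F w - xc F z) * (yc F w - yc F v) < (yc F w - yc F z) * (xc F w - xc F v).
Proof.
  unfold right_of. rewrite !xc_horizontal, !yc_horizontal. intros Hr.
  pose proof sin_cos_half as E.
  enough (0 < (sin h * sin h + cos h * cos h) *
    ((yc F w - yc F z) * (xc F w - xc F v) - (xc F w - xc F z) * (yc F w - yc F v)))
    by (rewrite E in *; lra).
  lra.
Qed.

(** The canonical triangle of [w] towards [v] lies inside the one of [u] towards [w]. *)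
Lemma cone_of_horizontal F u v w z :
  cone F u w -> cone F u v ->
  - (tan h * (yc F v - yc F u)) < xc F v - xc F u ->
  cone (horizontal_frame F) w z ->
  yc (horizontal_frame F) z <= yc (horizontal_frame F) v ->
  cone F u z.
Proof.
  intros [Hw1 Hw2] [Hv1 Hv2] Hv3 Hz. apply cone_horizontal in Hz.
  destruct Hz as (_ & Hz1 & Hz2). rewrite !yc_horizontal. intros Hz3.
  pose proof cos_half_pos; pose proof tan_half_cos as Ht; pose proof tan_half_pos.
  pose proof tan_half_le_cot.
  pose proof half_angle_pos; pose proof half_angle_le.
  assert (Hs2 : 0 < sin (2 * h)) by (apply sin_gt_0; lra).
  assert (Hz4 : tan h * (yc F w - yc F z) <= xc F w - xc F z).
  { apply (Rmult_le_reg_r (sin (2 * h))); [assumption|]. nra. }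
  assert (Hz5 : xc F v + tan h * yc F v <= xc F z + tan h * yc F z).
  { apply (Rmult_le_reg_r (cos h)); [assumption|].
    replace ((xc F v + tan h * yc F v) * cos h)
      with (xc F v * cos h + (tan h * cos h) * yc F v) by ring.
    replace ((xc F z + tan h * yc F z) * cos h)
      with (xc F z * cos h + (tan h * cos h) * yc F z) by ring.
    rewrite Ht. lra. }
  assert (0 < yc F z - yc F u) by (apply (Rmult_lt_reg_l (tan h)); nra).
  split; [assumption|split]; lra.
Qed.

(** A point [z] below the line [v w] in this triangle lies in the cone of [u], hence above [v] by
    the choice of [v]. The slope from [v] to [z] is then positive and smaller than that from [v] to
    [w], so [z] sees [v] in the same cone. *)
Lemma horizontal_right_free F u v w :
  is_frame F -> In u P -> In w P -> In v P ->
  cone F u w -> cone F u v ->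
  (forall z, In z P -> cone F u z -> yc F v <= yc F z) ->
  cone (horizontal_frame F) w v -> 0 < yc F w - yc F v ->
  right_free (horizontal_frame F) w v.
Proof.
  intros HF Hu Hw Hv Hcw Hcv Hmin Hwv Hvy z Hz Hcz Hyz Hrz.
  assert (Hv3 : - (tan h * (yc F v - yc F u)) < xc F v - xc F u).
  { pose proof (gp_xc F u v HF Hu Hv (cone_neq _ _ _ Hcv)).
    destruct Hcv as [_ [Hle _]]. lra. }
  pose proof (cone_of_horizontal F u v w z Hcw Hcv Hv3 Hcz Hyz) as Huz.
  pose proof (Hmin z Hz Huz) as Hvz.
  apply right_of_horizontal in Hrz.
  assert (Hne : v <> z) by (intros <-; lra).
  pose proof (gp_yc F v z HF Hv Hz Hne) as Hne'.
  apply cone_horizontal in Hwv. destruct Hwv as (_ & Hwv1 & Hwv2).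
  apply cone_horizontal.
  pose proof cos_half_pos; pose proof sin_half_pos.
  pose proof cos_2half_pos.
  pose proof half_angle_pos; pose proof half_angle_le.
  assert (Hs2 : 0 < sin (2 * h)) by (apply sin_gt_0; lra).
  assert (Hd : 0 < yc F z - yc F v) by lra.
  assert (Hslope : (yc F z - yc F v) * (xc F w - xc F v)
                   < (xc F z - xc F v) * (yc F w - yc F v)) by nra.
  assert (Hcone : (yc F z - yc F v) * cos (2 * h) <= (xc F z - xc F v) * sin (2 * h)).
  { apply (Rmult_le_reg_r (yc F w - yc F v)); [assumption|]. nra. }
  assert (0 < xc F z - xc F v) by (apply (Rmult_lt_reg_r (sin (2 * h))); nra).
  split; [nra|split; lra].
Qed.

(** * The induction steps *)

Lemma step_outside_cone F u v w :
  is_frame F -> In u P -> In w P -> In v P ->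
  bounded_below (yc F w - yc F u) ->
  cone F u w -> cone F u v ->
  (forall z, In z P -> cone F u z -> yc F v <= yc F z) ->
  0 < yc F w - yc F v -> tan h * (yc F w - yc F v) < xc F w - xc F v ->
  connected_within v w (corner F v w).
Proof.
  intros HF Hu Hw Hv IH Hcw Hcv Hmin Hy Hx.
  destruct (cone_cover _ _ Hy Hx) as (i & Hi & Hiy & Hix).
  (* Both [v] and [w] lie in the cone of [u], and [v] is off its left boundary by general position;
     this gives the strict bound on the offset in [rot_y_lt]. *)
  assert (Hlt : rot_y i (xc F w - xc F v) (yc F w - yc F v) < yc F w - yc F u).
  { replace (yc F w - yc F u) with ((yc F v - yc F u) + (yc F w - yc F v)) by ring.
    pose proof (gp_xc F u v HF Hu Hv (cone_neq _ _ _ Hcv)).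
    destruct Hcv as [? [? ?]], Hcw as [? [? ?]].
    apply rot_y_lt; try assumption. lra. }
  destruct (classic (rot_x i (xc F w - xc F v) (yc F w - yc F v) <= 0 \/ (i < k)%nat))
    as [Hor|Hor].
  - destruct (IH (rotate i F) v w) as [HA _]; try assumption.
    + now apply is_frame_rotate.
    + unfold cone. rewrite !xc_rotate, !yc_rotate, rot_x_sub, rot_y_sub. now split.
    + now rewrite !yc_rotate, rot_y_sub.
    + rewrite !xc_rotate, !yc_rotate, rot_x_sub, rot_y_sub in HA.
      apply (connected_within_le _ _ _ _ HA). now apply (rot_corner_le i).
  (* The lower half of the horizontal cone remains; the walk is found from [w] to [v] and
     reversed. *)
  - assert (i = k) by (destruct (Nat.lt_ge_cases i k); [tauto|lia]). subst i.
    unfold rot_x, rot_y in *. destruct rot_k as [Ec Es]. rewrite Ec, Es in *.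
    assert (Hwv : cone (horizontal_frame F) w v).
    { unfold cone. rewrite !xc_horizontal, !yc_horizontal. split; lra. }
    apply connected_within_sym. rewrite <- corner_horizontal.
    destruct (IH (horizontal_frame F) w v) as [_ HD]; try assumption.
    + now apply is_frame_oppose, is_frame_rotate.
    + rewrite !yc_horizontal. lra.
    + apply HD. now apply horizontal_right_free with u.
Qed.

Lemma corner_trans F u v w : corner F u v + corner F v w = corner F u w.
Proof. unfold corner; ring. Qed.

Lemma edge_then F u v w r :
  is_frame F -> cone F u v -> theta_adj m P u v ->
  connected_within v w r -> connected_within u w (corner F u v + r).
Proof.
  intros HF Hc Ha Hr. apply connected_within_trans with v; [|exact Hr].
  apply (connected_within_le _ _ _ _ (connected_within_edge _ _ Ha)).
  now apply edge_le_corner.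
Qed.

Lemma step_max F u w :
  is_frame F -> In u P -> In w P -> cone F u w ->
  bounded_below (yc F w - yc F u) ->
  connected_within u w (kappa * (yc F w - yc F u) + Rabs (xc F w - xc F u)).
Proof.
  intros HF Hu Hw Hc IH.
  destruct (closest_neighbour F u w HF Hu Hw Hc) as (v & Hv & Hcv & Ha & Hmin).
  (* After mirroring if necessary, [w] is not to the left of [v], so inside the cone of [v] the
     longer corner route to [w] is the left one. *)
  enough (Hgen : forall G, is_frame G -> yc G = yc F -> cone G u w -> cone G u v ->
    (forall z, cone G u z -> cone F u z) ->
    0 <= xc G w - xc G v -> connected_within u w (corner G u w)).
  { destruct (Rle_dec 0 (xc F w - xc F v)) as [Hs|Hs].
    - apply connected_within_le with (corner F u w); [now apply Hgen|].
      unfold corner. pose proof (Rle_abs (xc F w - xc F u)); lra.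
    - apply connected_within_le with (corner (flip F) u w).
      + apply Hgen; auto using is_frame_flip, cone_flip.
        * unfold cone; intros z. rewrite !xc_flip, !yc_flip. lra.
        * rewrite !xc_flip; lra.
      + unfold corner. rewrite !xc_flip, !yc_flip.
        pose proof (Rle_abs (- (xc F w - xc F u))) as Hr.
        rewrite Rabs_Ropp in Hr; lra. }
  clear Hc Hcv HF. intros G HG Ey Hc Hcv Hsub Hs. rewrite <- Ey in *.
  destruct (classic (v = w)) as [->|Hne].
  { apply (connected_within_le _ _ _ _ (connected_within_edge _ _ Ha)).
    now apply edge_le_corner. }
  rewrite <- (corner_trans G u v w). apply edge_then; try assumption.
  assert (Hy : 0 < yc G w - yc G v).
  { pose proof (gp_yc G v w HG Hv Hw Hne). pose proof (Hmin w Hw (Hsub w Hc)). lra. }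
  destruct (Rle_dec (xc G w - xc G v) (tan h * (yc G w - yc G v))) as [Hx|Hx].
  - destruct (IH G v w) as [HA _]; try assumption.
    + pose proof tan_half_pos. split; [assumption|split; nra].
    + destruct Hcv; lra.
    + rewrite Rabs_pos_eq in HA by assumption. exact HA.
  - apply step_outside_cone with u; auto. lra.
Qed.

Lemma step_corner F u w :
  is_frame F -> In u P -> In w P -> cone F u w ->
  bounded_below (yc F w - yc F u) -> right_free F u w ->
  connected_within u w (corner F u w).
Proof.
  intros HF Hu Hw Hc IH Hfree.
  set (right x := cone F u x /\ yc F x <= yc F w /\ right_of F u w x).
  destruct (classic (exists x, In x P /\ right x)) as [Hex|Hempty].
  - destruct (exists_argmin (yc F) right P Hex) as (x & Hx & (Hcx & Hyx & Hrx) & Hmin).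
    pose proof (Hfree x Hx Hcx Hyx Hrx) as Hxw.
    rewrite <- (corner_trans F u x w). apply connected_within_trans with x.
    + destruct (IH F u x) as [_ HD]; try assumption.
      { destruct Hxw; lra. }
      (* Such a [y] would also be right of [u w] and no higher than [x], the lowest such point;
         general position excludes a tie. *)
      apply HD. intros y Hy Hcy Hyy Hry. exfalso.
      assert (Hne : x <> y) by (intros <-; unfold right_of in Hry; lra).
      apply (gp_yc F x y HF Hx Hy Hne).
      enough (yc F x <= yc F y) by lra.
      apply Hmin; [assumption|]. split; [assumption|split; [lra|]].
      destruct Hc as [Hc1 _], Hcx as [Hcx1 _], Hcy as [Hcy1 _].
      unfold right_of in *.
      set (d1 := yc F w - yc F u) in *. set (p1 := yc F x - yc F u) in *.
      set (q1 := yc F y - yc F u) in *. set (d0 := xc F w - xc F u) in *.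
      set (p0 := xc F x - xc F u) in *. set (q0 := xc F y - xc F u) in *.
      apply (Rmult_lt_reg_l p1); [assumption|]. nra.
    + destruct (IH F x w) as [_ HD]; try assumption.
      { destruct Hcx; lra. }
      (* As [x] is right of [u w], so is every [y] of its triangle right of [x w], and [Hfree]
         applies to it. *)
      apply HD. intros y Hy Hcy Hyy Hry.
      apply Hfree; [assumption|now apply cone_trans with x|assumption|].
      destruct Hc as [Hc1 _], Hcx as [Hcx1 _], Hxw as [Hxw1 _].
      unfold right_of in *.
      apply (Rmult_lt_reg_l (yc F w - yc F x)); [assumption|].
      assert (0 <= (yc F w - yc F y) *
        ((xc F x - xc F u) * (yc F w - yc F u) - (yc F x - yc F u) * (xc F w - xc F u)))
        by (apply Rmult_le_pos; lra).
      assert (0 < (yc F w - yc F u) * ((xc F y - xc F x) * (yc F w - yc F x)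
         - (yc F y - yc F x) * (xc F w - xc F x))) by (apply Rmult_lt_0_compat; lra).
      lra.
  - assert (Hleft : forall y, In y P -> cone F u y -> yc F y <= yc F w ->
        (xc F y - xc F u) * (yc F w - yc F u) <= (yc F y - yc F u) * (xc F w - xc F u)).
    { intros y Hy Hcy Hyy. apply Rnot_lt_le. intros Hr. apply Hempty.
      exists y; split; [assumption|]. split; [assumption|split; [assumption|]].
      unfold right_of; lra. }
    destruct (closest_neighbour F u w HF Hu Hw Hc) as (v & Hv & Hcv & Ha & Hmin).
    destruct (classic (v = w)) as [->|Hne].
    { apply (connected_within_le _ _ _ _ (connected_within_edge _ _ Ha)).
      now apply edge_le_corner. }
    rewrite <- (corner_trans F u v w). apply edge_then; try assumption.
    assert (Hy : 0 < yc F w - yc F v).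
    { pose proof (gp_yc F v w HF Hv Hw Hne). pose proof (Hmin w Hw Hc). lra. }
    (* a point of the triangle on the left of [u w] sees [w] to the right of the
       left boundary of its own cone *)
    assert (Hback : forall y, In y P -> cone F u y -> yc F y <= yc F w ->
        - (tan h * (yc F w - yc F y)) <= xc F w - xc F y).
    { intros y Hy' Hcy Hyy. pose proof (Hleft y Hy' Hcy Hyy) as Hl.
      destruct Hc as [Hc1 [Hc2 _]].
      apply (Rmult_le_reg_r (yc F w - yc F u)); [assumption|].
      assert (0 <= (yc F w - yc F y) * (xc F w - xc F u + tan h * (yc F w - yc F u)))
        by (apply Rmult_le_pos; lra).
      lra. }
    destruct (Rle_dec (xc F w - xc F v) (tan h * (yc F w - yc F v))) as [Hx|Hx].
    + destruct (IH F v w) as [_ HD]; try assumption.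
      { split; [assumption|]. split; [apply Hback; auto; lra|assumption]. }
      { destruct Hcv; lra. }
      (* The left boundary is respected by [Hback]; the right one because [y], being right of [v w],
         sees [w] leaning no further right than [v] does. *)
      apply HD. intros y Hy' Hcy Hyy Hry.
      assert (Hne' : y <> w) by (intros ->; unfold right_of in Hry; lra).
      pose proof (gp_yc F y w HF Hy' Hw Hne').
      split; [lra|]. split; [apply Hback; auto; now apply cone_trans with v|].
      unfold right_of in Hry.
      apply (Rmult_le_reg_r (yc F w - yc F v)); [assumption|].
      assert (0 <= (yc F w - yc F y) * (tan h * (yc F w - yc F v) - (xc F w - xc F v)))
        by (apply Rmult_le_pos; lra).
      lra.
    + apply step_outside_cone with u; auto. lra.
Qed.

(** * Induction on the heights of canonical triangles *)

(** The number of entries of [V] below a value drops strictly from [r] to a smaller entry [r'],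
    because [r'] itself is no longer counted. *)
Lemma value_list_ind (V : list R) (Q : R -> Prop) :
  (forall r, In r V -> (forall r', In r' V -> r' < r -> Q r') -> Q r) ->
  forall r, In r V -> Q r.
Proof.
  intros Hstep.
  set (below r := length (filter (fun x => if Rlt_dec x r then true else false) V)).
  assert (Hmono : forall r' r, In r' V -> r' < r -> (below r' < below r)%nat).
  { intros r' r Hin Hlt. unfold below. clear Hstep below. induction V as [|a V IH]; [destruct Hin|].
    assert (Hle : (length (filter (fun x => if Rlt_dec x r' then true else false) V)
      <= length (filter (fun x => if Rlt_dec x r then true else false) V))%nat).
    { clear IH Hin. induction V as [|b V IHV]; simpl; [lia|].
      destruct (Rlt_dec b r'), (Rlt_dec b r); simpl; lia || lra. }
    simpl. destruct Hin as [->|Hin].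
    - destruct (Rlt_dec r' r'), (Rlt_dec r' r); simpl; lia || lra.
    - specialize (IH Hin). destruct (Rlt_dec a r'), (Rlt_dec a r); simpl; lia || lra. }
  enough (Hn : forall n r, In r V -> (below r < n)%nat -> Q r) by eauto.
  induction n as [|n IH]; intros r Hin Hr; [lia|].
  apply Hstep; [assumption|]. intros r' Hin' Hlt. apply IH; [assumption|].
  specialize (Hmono r' r Hin' Hlt). lia.
Qed.

Lemma all_pairs_bounded F u w :
  is_frame F -> In u P -> In w P -> cone F u w -> bounded_pair F u w.
Proof.
  (* All heights that can occur; indices below [m] suffice because bisectors are periodic. *)
  set (V := flat_map (fun a => flat_map (fun b =>
    map (fun j => dot b (bisector m j) - dot a (bisector m j)) (seq 0 m)) P) P).
  assert (HV : forall G a b, is_frame G -> In a P -> In b P -> In (yc G b - yc G a) V).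
  { intros G a b (j & He & _) Ha Hb. rewrite <- bisector_mod in He.
    unfold V. apply in_flat_map; exists a; split; [assumption|].
    apply in_flat_map; exists b; split; [assumption|].
    apply in_map_iff; exists (j mod m). split; [unfold yc; now rewrite He|].
    apply in_seq; split; [lia|]. apply Nat.mod_upper_bound; lia. }
  intros HF Hu Hw Hc.
  enough (H : forall r, In r V -> forall G a b, is_frame G -> In a P -> In b P ->
    cone G a b -> yc G b - yc G a = r -> bounded_pair G a b)
    by now apply (H _ (HV F u w HF Hu Hw)).
  clear F u w HF Hu Hw Hc.
  apply (value_list_ind V (fun r => forall G a b, is_frame G -> In a P -> In b P ->
    cone G a b -> yc G b - yc G a = r -> bounded_pair G a b)).
  intros r Hr IH G a b HG Ha Hb Hc Er.
  assert (Hbelow : bounded_below (yc G b - yc G a)).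
  { intros F u w HF Hu Hw Hcuw Hlt. rewrite Er in Hlt.
    apply (IH (yc F w - yc F u)); auto. }
  split; [now apply step_max|intros; now apply step_corner].
Qed.

End Angles.

(** * The angle of the statement in frame coordinates, and the conclusion *)

(** The bound of the theorem is the longer of the two routes from [u] to [w] through
    a corner of the canonical triangle, written in the frame of its cone. *)
Lemma angle_tri_mid (m i : nat) (u w : point) (X Y : R) :
  Y = proj m i u w -> 0 < Y -> X ^ 2 + Y ^ 2 = edist u w ^ 2 ->
  cos (angle (vsub w u) (vsub (tri_mid m i u w) u)) * edist u w = Y /\
  sin (angle (vsub w u) (vsub (tri_mid m i u w) u)) * edist u w = Rabs X.
Proof.
  intros EY HY Hr.
  assert (Hr0 : 0 <= edist u w) by apply sqrt_pos.
  assert (Hr1 : 0 < edist u w) by nra.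
  assert (E : dot (vsub w u) (vsub (tri_mid m i u w) u) /
    (sqrt (dot (vsub w u) (vsub w u)) *
     sqrt (dot (vsub (tri_mid m i u w) u) (vsub (tri_mid m i u w) u))) = Y / edist u w).
  { replace (dot (vsub w u) (vsub (tri_mid m i u w) u)) with (Y * Y)
      by (rewrite EY; unfold tri_mid, proj, dot, vsub; cbn [fst snd]; ring).
    replace (dot (vsub (tri_mid m i u w) u) (vsub (tri_mid m i u w) u)) with (Y * Y).
    2: { unfold tri_mid; rewrite <- EY.
         pose proof (sin2_cos2 (PI / 2 - INR i * theta m)) as E; unfold Rsqr in E.
         unfold dot, vsub, bisector, dir; cbn [fst snd].
         transitivity (Y * Y * 1); [ring|rewrite <- E; ring]. }
    replace (sqrt (dot (vsub w u) (vsub w u))) with (edist u w)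
      by (unfold edist, dot, vsub; cbn [fst snd]; f_equal; ring).
    rewrite sqrt_square by lra. field; lra. }
  unfold angle; rewrite E.
  assert (HX : Rabs X ^ 2 = X ^ 2) by apply pow2_abs.
  pose proof (Rabs_pos X).
  assert (HYr : Y <= edist u w) by (apply Rsqr_incr_0_var; [unfold Rsqr; nra|assumption]).
  assert (HYr' : 0 <= Y / edist u w <= 1).
  { split; [apply Rle_mult_inv_pos; lra|]. apply (Rmult_le_reg_r (edist u w)); [assumption|].
    replace (Y / edist u w * edist u w) with Y by (field; lra). lra. }
  rewrite cos_acos, sin_acos by lra. split; [field; lra|].
  replace (1 - (Y / edist u w)²) with ((Rabs X / edist u w) ^ 2).
  - rewrite sqrt_pow2; [field; lra|]. apply Rle_mult_inv_pos; lra.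
  - apply (Rmult_eq_reg_r (edist u w ^ 2)); [|nra].
    transitivity (Rabs X ^ 2); [field; lra|].
    transitivity (edist u w ^ 2 - Y ^ 2); [lra|unfold Rsqr; field; lra].
Qed.

Theorem mainTheorem5 (k : nat) (P : list point) (u w : point) (i : nat) :
  (1 <= k)%nat ->
  NoDup P ->
  general_position (4 * k + 2) P ->
  In u P -> In w P -> u <> w ->
  in_cone (4 * k + 2) i u w ->
  exists l : list point,
    NoDup (u :: l) /\
    is_walk (theta_adj (4 * k + 2) P) u l /\
    last l u = w /\
    path_length u l <=
      ((1 + sin (theta (4 * k + 2) / 2)) / cos (theta (4 * k + 2) / 2)
         * cos (angle (vsub w u) (vsub (tri_mid (4 * k + 2) i u w) u))
       + sin (angle (vsub w u) (vsub (tri_mid (4 * k + 2) i u w) u)))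
      * edist u w.
Proof.
  intros k_pos _ gp Hu Hw _ Hin.
  set (b := bisector (4 * k + 2) i).
  (* The mirrored second axis would serve as well, since the first bound of [bounded_pair] is
     symmetric in [xc]. *)
  set (F := (b, (snd b, - fst b))).
  assert (HF : is_frame k F) by (exists i; split; [|left]; reflexivity).
  assert (Hc : cone k F u w)
    by (apply (in_cone_iff k k_pos F i); [apply Hin|exact HF|reflexivity|exact Hin]).
  destruct (all_pairs_bounded k k_pos P gp F u w HF Hu Hw Hc) as [HA _].
  apply connected_within_simple. apply (connected_within_le _ _ _ _ _ _ HA).
  fold (half_angle k). fold (kappa k).
  destruct (angle_tri_mid (4 * k + 2) i u w (xc F w - xc F u) (yc F w - yc F u))
    as [Ec Es].
  - unfold yc, proj, dot, vsub; cbn [fst snd F]; fold b; ring.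
  - apply Hc.
  - rewrite (frame_dist2 k F u w HF). unfold edist. rewrite pow2_sqrt; [reflexivity|].
    pose proof (pow2_ge_0 (fst u - fst w)); pose proof (pow2_ge_0 (snd u - snd w)); lra.
  - rewrite Rmult_plus_distr_r, Rmult_assoc, Ec, Es. lra.
Qed.
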